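(* Let $a,b\in\mathbb{Z}$ and $\mathbf{u}=(u_n)_{n\in\mathbb{N}}\in\{0,1\}^{\mathbb{N}}$. Let $f(0)=f(1)=1$, $f(2)=a+b$ and $f(n)=af(n-u_n-1)+bf(n-u_n-2)$ for $n\ge 3$. Let $g(0)=g(1)=1$ and $g(n)=ag(n-1)+bg(n-2)$ for $n\ge 2$. Assume that for each $d\in\mathbb{N}$ there exists an integer $n_d\ge 2$ such that $u_{n_d}=0$, $u_{n_d+1}=1$, and $u_{n_d+j}=0$ for each $j\in\{2,\ldots,d\}$. If $f(n_d)\ne 0$ for infinitely many values of $d$, then $$\mathcal{V}(g)\subset\mathcal{V}(f).$$ If additionally $a\ne 0$, $a+b\ne 1$ and $b\notin\left\{-a^2,-\frac{a^2}{2},-\frac{a^2}{3}\right\}$, then the set $\mathcal{V}(f)$ is infinite.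
   Context: $\mathbb{N}=\{0,1,2,\ldots\}$. For a sequence $(s(n))_{n\in\mathbb{N}}$ of numbers, $\mathcal{V}(s)=\{s(n+1)/s(n): n\in\mathbb{N}\}$ denotes its set of quotients of consecutive terms, where only quotients that are defined (i.e. $s(n)\neq 0$) are considered.
   Formalization: The second claim (that V(f) is infinite) is proved under the additional assumption b ≠ 0; for b = 0 it is false, since then V(f) is contained in {1, a} (e.g. a = −1, b = 0 gives f with values ±1 only). *)

(* Defs.v *)
From HB Require Import structures.
From mathcomp Require Import all_boot all_order all_algebra.
From mathcomp Require Import boolp classical_sets functions cardinality.

Set Implicit Arguments.
Unset Strict Implicit.
Unset Printing Implicit Defensive.

Import Order.TTheory GRing.Theory Num.Theory.

Local Open Scope ring_scope.
Local Open Scope classical_set_scope.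

Definition quotient_set (s : nat -> int) : set rat :=
  [set (s n.+1)%:~R / (s n)%:~R | n in [set n | s n != 0]].

(* Main.v *)
Require Import Defs.
From HB Require Import structures.
From mathcomp Require Import all_boot all_order all_algebra.
From mathcomp Require Import ring lra zify.
From mathcomp Require Import boolp classical_sets functions cardinality.

Set Implicit Arguments.
Unset Strict Implicit.

Import Order.TTheory GRing.Theory Num.Theory.

Local Open Scope ring_scope.
Local Open Scope classical_set_scope.

(** From an index [n] with [u n = 0], [u n.+1 = 1] the recurrence for [f] gives
    [f n = a f(n-1) + b f(n-2) = f n.+1]: two equal consecutive values, that is,
    the initial values of [g] up to the factor [f n].  As long as [u] then stays
    zero, [f] obeys the recurrence of [g], so [f (n + j) = f n * g j].  Long
    enough such blocks with [f n != 0] reproduce every quotient of [g].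

    It remains to see that [g] has infinitely many quotients.  The Casorati
    determinant of [g] and its shift by [k] is
    [g(i+1) g(i+k) - g(i) g(i+k+1) = (-b)^i (1 - a - b) U_k], where [U] is the
    Lucas sequence [0, 1, a, ...] of the same recurrence
    ([linrec_casorati], [linrec_diff]).  So if [U_k] vanishes for no [k > 0],
    all quotients of [g] are distinct.

    If [U_k = 0] with [k > 0], then the ratio of the two roots of [X^2 - aX - b]
    is a root of unity, whence the number [s = -(a^2 + 2b)/b], which is the sum
    of this ratio and its inverse, is a rational algebraic integer of absolute
    value at most 2.  The excluded [b] are those with [s = -1, 0, 1], while
    [s = -2] means [a = 0] and [s = 2] is a double root.  The proof avoids
    roots: also [U_(2k) = 0], and [U_(2n)] is, up to a nonzero factor,
    the Lucas sequence with parameters [s] and [-1] ([lucasU_double],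
    [lucasU_scale]).  With [s = p/q] in lowest terms, clearing denominators
    makes it congruent to [p^(n-1)] modulo [q], so that [q = 1]
    ([lucasU_mod]), and it increases in absolute value when [|s| >= 2]
    ([lucasU_growth]), so that [|s| <= 1]. *)

(** * Linear recurrences of order two *)

Section LinearRecurrence.
Variable R : comNzRingType.
Implicit Types (a b c : R) (v : nat -> R).

Definition linrec a b v := forall n, v n.+2 = a * v n.+1 + b * v n.

Fixpoint lucasU a b n : R :=
  match n with
  | 0%N => 0
  | n'.+1 => match n' with
             | 0%N => 1
             | m.+1 => a * lucasU a b n' + b * lucasU a b m
             end
  end.

Lemma lucasU_linrec a b : linrec a b (lucasU a b).
Proof. by []. Qed.

(** All identities below between Lucas sequences are instances of this
    uniqueness statement. *)
Lemma linrec_lucasU a b v n :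
  linrec a b v -> v 0%N = 0 -> v n = v 1%N * lucasU a b n.
Proof.
move=> vrec v0.
suff: v n = v 1%N * lucasU a b n /\ v n.+1 = v 1%N * lucasU a b n.+1 by case.
elim: n => [|n [IH1 IH2]]; first by rewrite /= mulr0 mulr1 v0.
by split; rewrite // vrec lucasU_linrec IH1 IH2; ring.
Qed.

Lemma linrec_diff a b v k : linrec a b v -> v 0%N = 1 -> v 1%N = 1 ->
  v k.+1 - v k = (a + b - 1) * lucasU a b k.
Proof.
move=> vrec v0 v1.
rewrite (@linrec_lucasU a b (fun k => v k.+1 - v k)) ?v0 ?v1 ?subrr //.
  by rewrite vrec v0 v1; ring.
by move=> n; rewrite !vrec; ring.
Qed.

(** One step of the recurrence multiplies the pair of columns
    [(v_i, v_(i+1))], [(v_(i+k), v_(i+k+1))] by a matrix of determinant [-b]. *)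
Lemma linrec_casorati a b v i k : linrec a b v ->
  v i.+1 * v (i + k)%N - v i * v (i + k).+1 =
  (- b) ^+ i * (v 1%N * v k - v 0%N * v k.+1).
Proof.
move=> vrec; elim: i => [|i IH]; first by rewrite expr0 mul1r.
by rewrite exprS -mulrA -IH addSn !vrec; ring.
Qed.

(** After a zero at [k] the sequence restarts, up to a factor, from [0, 1]. *)
Lemma lucasU_eq0_double a b k : lucasU a b k = 0 -> lucasU a b k.*2 = 0.
Proof.
move=> Uk0; rewrite -addnn.
rewrite (@linrec_lucasU a b (fun j => lucasU a b (j + k))) ?add0n //.
by rewrite Uk0 mulr0.
Qed.

(** The squares of the roots of [X^2 - aX - b] have sum [a^2 + 2b] and
    product [b^2]. *)
Lemma lucasU_double a b n :
  lucasU a b n.*2 = a * lucasU (a ^+ 2 + b *+ 2) (- b ^+ 2) n.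
Proof.
rewrite (@linrec_lucasU (a ^+ 2 + b *+ 2) (- b ^+ 2) (fun j => lucasU a b j.*2)) //.
  by congr (_ * _) => /=; ring.
by move=> m; rewrite !doubleS !lucasU_linrec; ring.
Qed.

(** Multiplying both roots of [X^2 - aX - b] by [c]. *)
Lemma lucasU_scale c a b n :
  c ^+ n * lucasU a b n = c * lucasU (c * a) (c ^+ 2 * b) n.
Proof.
rewrite (@linrec_lucasU (c * a) (c ^+ 2 * b) (fun j => c ^+ j * lucasU a b j)).
- by rewrite expr1 /= mulr1.
- by move=> m; rewrite lucasU_linrec !exprS; ring.
- by rewrite mulr0.
Qed.

End LinearRecurrence.

(** * Vanishing of integer Lucas sequences *)

(** Modulo [q] the recurrence degenerates to [U_(n+1) = p U_n]. *)
Lemma lucasU_mod (p r q : int) n :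
  (q %| r)%Z -> (q %| lucasU p r n.+1 - p ^+ n)%Z.
Proof.
move=> qr; elim: n => [|n IH]; first by rewrite subrr dvdz0.
have -> : lucasU p r n.+2 - p ^+ n.+1 =
    p * (lucasU p r n.+1 - p ^+ n) + r * lucasU p r n.
  by rewrite lucasU_linrec exprS; ring.
by apply: rpredD; [exact: dvdz_mull | exact: dvdz_mulr].
Qed.

(** Here [|U_(n+2)| >= 2|U_(n+1)| - |U_n|], so the increments of [|U_n|]
    cannot decrease. *)
Lemma lucasU_growth (p : int) n :
  2 <= `|p| -> `|lucasU p (- 1) n| < `|lucasU p (- 1) n.+1|.
Proof.
move=> p2; elim: n => [|n IH]; first by [].
rewrite lucasU_linrec.
set x := lucasU p (- 1) n.+1 in IH *; set y := lucasU p (- 1) n in IH *.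
have le1 : 2 * `|x| <= `|p * x| by rewrite normrM ler_wpM2r.
have le2 : `|p * x| - `|y| <= `|p * x + -1 * y|.
  by rewrite mulN1r; apply: lerB_dist.
lia.
Qed.

(** In terms of the roots, [s] below is the sum of their ratio and its inverse;
    reducing it to [p / q] and scaling moves the vanishing from the parameters
    [(a^2 + 2b, -b^2)] to [(p, -q^2)].  The three conclusions are
    [p = -1, 0, 1]. *)
Lemma lucasU_eq0 (a b : int) k : a != 0 -> b != 0 -> lucasU a b k.+1 = 0 ->
  [\/ b = - a ^+ 2, 2 * b = - a ^+ 2 | 3 * b = - a ^+ 2].
Proof.
move=> a0 b0 /lucasU_eq0_double; rewrite lucasU_double => /eqP.
rewrite mulf_eq0 (negbTE a0) orFb => /eqP U0.
pose s : rat := (a ^+ 2 + b *+ 2)%:~R / (- b)%:~R :> rat.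
pose p := numq s; pose q := denq s.
have q0 : q != 0 by apply: denq_neq0.
have pqE : q * (a ^+ 2 + b *+ 2) = - b * p.
  apply: (@intr_inj rat); rewrite !intrM.
  have bQ : (- b)%:~R != 0 :> rat by rewrite intr_eq0 oppr_eq0.
  have qQ : q%:~R != 0 :> rat by rewrite intr_eq0.
  have : p%:~R / q%:~R = (a ^+ 2 + b *+ 2)%:~R / (- b)%:~R :> rat.
    exact: divq_num_den.
  move=> /eqP; rewrite eqr_div // => /eqP E.
  by rewrite mulrC -E mulrC.
(* Scaling [(a^2 + 2b, -b^2)] by [q] and [(p, -q^2)] by [- b] gives the same
   pair of parameters. *)
have T0 : lucasU p (- q ^+ 2) k.+1 = 0.
  have := lucasU_scale (- b) p (- q ^+ 2) k.+1.
  rewrite -pqE.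
  have -> : (- b) ^+ 2 * (- q ^+ 2) = q ^+ 2 * (- b ^+ 2) by ring.
  have := lucasU_scale q (a ^+ 2 + b *+ 2) (- b ^+ 2) k.+1.
  rewrite U0 mulr0 => /esym/eqP; rewrite mulf_eq0 (negbTE q0) orFb => /eqP ->.
  move=> /eqP; rewrite mulr0 mulf_eq0 expf_eq0 oppr_eq0 (negbTE b0) andbF orFb.
  by move=> /eqP.
have q1 : q = 1.
  have := @lucasU_mod p (- q ^+ 2) q k.
  rewrite T0 sub0r rpredN rpredN expr2 dvdz_mulr ?dvdzz // => /(_ isT) qp.
  have cop : coprimez q (p ^+ k).
    by rewrite coprimezXr // /coprimez gcdzC /gcdz /= (eqP (coprime_num_den s)).
  have : (q %| p ^+ k * 1)%Z by rewrite mulr1.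
  rewrite Gauss_dvdzr // dvdz1 => /eqP.
  have := denq_gt0 s; rewrite -/q; lia.
have p2 : `|p| < 2.
  rewrite ltNge; apply/negP => /(lucasU_growth k).
  by move: T0; rewrite q1 expr1n => ->; rewrite normr0 ltNge normr_ge0.
move: pqE; rewrite q1 mul1r => pqE.
have [pE|[pE|pE]] : p = -1 \/ p = 0 \/ p = 1 by lia.
- by apply: Or31; move: pqE; rewrite pE; lia.
- by apply: Or32; move: pqE; rewrite pE; lia.
- by apply: Or33; move: pqE; rewrite pE; lia.
Qed.

(** * Quotients of consecutive terms *)

Lemma infinite_set_nat_unbounded (A : set nat) m :
  infinite_set A -> exists2 n, A n & (m <= n)%N.
Proof.
move=> Ainf; apply: contrapT => nex; apply: Ainf.
apply: (@sub_finite_set _ _ `I_m); last exact: finite_II.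
move=> n An /=; rewrite ltnNge; apply/negP => mn; apply: nex; by exists n.
Qed.

Section Quotients.
Variables (a b : int) (g : nat -> int).
Hypotheses (grec : linrec a b g) (g0 : g 0%N = 1) (g1 : g 1%N = 1).

Lemma quotient_cross i k :
  g i.+1 * g (i + k)%N - g i * g (i + k).+1 =
  (- b) ^+ i * (1 - a - b) * lucasU a b k.
Proof.
have := linrec_diff k grec g0 g1.
rewrite (linrec_casorati i k grec) g0 g1 => /esym E.
have -> : 1 * g k - 1 * g k.+1 = - (g k.+1 - g k) by ring.
by rewrite -E; ring.
Qed.

Hypotheses (b0 : b != 0) (ab1 : a + b != 1).
Hypothesis lucasU_neq0 : forall k, lucasU a b k.+1 != 0.

Lemma quotient_cross_neq0 i k :
  g i.+1 * g (i + k.+1)%N != g i * g (i + k.+1).+1.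
Proof.
rewrite -subr_eq0 quotient_cross !mulf_neq0 ?expf_neq0 ?oppr_eq0 //.
by apply: contra ab1 => /eqP E; apply/eqP; lia.
Qed.

(** For [k = 1] the cross product rules out two consecutive zeros; every
    index is thus in the set or precedes one of its elements. *)
Lemma infinite_linrec_neq0 : infinite_set [set n | g n != 0].
Proof.
set A := [set n | g n != 0] => Afin; apply: infinite_nat.
apply: (@sub_finite_set _ _ (A `|` predn @` A)); last first.
  by rewrite finite_setU; split=> //; apply: finite_image.
move=> n _; have [gn|gn] := eqVneq (g n) 0; last by left.
right; exists n.+1 => //=.
have := quotient_cross_neq0 n 0; rewrite gn mul0r.
by apply: contra => /eqP ->; rewrite mul0r.
Qed.

Lemma infinite_quotient_set : infinite_set (quotient_set g).
Proof.
move=> fin; apply: infinite_linrec_neq0; move: fin.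
set A := [set n | _]; set h := fun n => (g n.+1)%:~R / (g n)%:~R : rat.
have lt_neq i j : g i != 0 -> g j != 0 -> (i < j)%N -> h i <> h j.
  move=> gi gj ij /eqP; rewrite /h eqr_div ?intr_eq0 //.
  rewrite -!intrM (inj_eq intr_inj); apply/negP.
  have := quotient_cross_neq0 i (j - i.+1).
  by rewrite addnS -addSn subnKC // (mulrC (g j.+1)).
suff hinj : {in A &, injective h}.
  by rewrite /quotient_set -/h (eq_finite_set (inj_card_eq hinj)).
move=> i j /set_mem gi /set_mem gj hij.
by case: (ltngtP i j) => // ij; exfalso;
  [apply: (lt_neq i j)|apply: (lt_neq j i)].
Qed.

End Quotients.

Theorem theorem6p2 (a b : int) (u : nat -> nat)
  (hu : forall n : nat, u n = 0%N \/ u n = 1%N)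
  (f : nat -> int)
  (hf0 : f 0%N = 1) (hf1 : f 1%N = 1) (hf2 : f 2%N = a + b)
  (hf : forall n : nat, (3 <= n)%N ->
     f n = a * f (n - u n - 1)%N + b * f (n - u n - 2)%N)
  (g : nat -> int)
  (hg0 : g 0%N = 1) (hg1 : g 1%N = 1)
  (hg : forall n : nat, (2 <= n)%N ->
     g n = a * g (n - 1)%N + b * g (n - 2)%N)
  (N : nat -> nat)
  (hN : forall d : nat,
     [/\ (2 <= N d)%N, u (N d) = 0%N, u (N d + 1)%N = 1%N
       & forall j : nat, (2 <= j <= d)%N -> u (N d + j)%N = 0%N])
  (hfN : infinite_set [set d : nat | f (N d) != 0]) :
  quotient_set g `<=` quotient_set f /\
  (a != 0 -> b != 0 -> a + b != 1 ->
   (b%:~R : rat) \notin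
     [:: - (a%:~R ^+ 2); - (a%:~R ^+ 2 / 2); - (a%:~R ^+ 2 / 3)] ->
   infinite_set (quotient_set f)).
Proof.
have grec : linrec a b g by move=> n; rewrite hg // subn1 subn2.
(* For [N d = 2] the value [f 2] is prescribed, consistently with the
   recurrence. *)
have fN d : f (N d) = a * f (N d - 1)%N + b * f (N d - 2)%N.
  have [N2 uN _ _] := hN d; have [N3|N3] := leqP 3 (N d).
    by rewrite {1}hf // uN subn0.
  have -> : N d = 2%N by lia.
  by rewrite hf2 hf1 hf0 !mulr1.
have fNS d : f (N d).+1 = f (N d).
  have [N2 _ uN _] := hN d.
  rewrite fN hf ?ltnS // -addn1 uN addnK //.
have block d j : (j <= d)%N -> f (N d + j)%N = f (N d) * g j.
  have [N2 _ _ uN] := hN d.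
  elim/ltn_ind: j => -[|[|j]] IH jd.
  - by rewrite addn0 hg0 mulr1.
  - by rewrite addn1 fNS hg1 mulr1.
  - rewrite hf ?uN ?subn0 //; last by lia.
    have -> : (N d + j.+2 - 1 = N d + j.+1)%N by lia.
    have -> : (N d + j.+2 - 2 = N d + j)%N by lia.
    by rewrite !IH ?grec; [ring|lia..].
have sub_gf : quotient_set g `<=` quotient_set f.
  move=> _ [n gn <-].
  have [d fd nd] := infinite_set_nat_unbounded n.+1 hfN.
  exists (N d + n)%N => /=; rewrite -?addnS !block ?(ltnW nd) //.
    by rewrite mulf_neq0.
  by rewrite !intrM -mulf_div divff ?mul1r // intr_eq0.
split=> // a0 b0 ab1; rewrite !inE !negb_or => /and3P[b1 b2 b3].
apply: (sub_infinite_set sub_gf).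
apply: (infinite_quotient_set grec) => // k.
apply/eqP => /(lucasU_eq0 a0 b0).
case=> /(congr1 (fun z : int => z%:~R : rat)) E.
- by move: b1; rewrite E rmorphN rmorphXn eqxx.
- move: E b2; rewrite intrM rmorphN rmorphXn /= => E /eqP; apply; lra.
- move: E b3; rewrite intrM rmorphN rmorphXn /= => E /eqP; apply; lra.
Qed.
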